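(* Let $(G,\sigma)$ be a signed graph and $t, k \geq 0$ integers. If $\chi_{sym}(G,\sigma) = t+ 2k$, where $t$ is the maximum integer in $\{0,\dots,\chi(G)\}$ with $\chi_{sym}^t(G,\sigma)=\chi_{sym}(G,\sigma)$, then $G$ has at least $k$ pairwise vertex-disjoint odd circuits which are unbalanced in $(G,\sigma)$. In particular, $k \leq l(G, \sigma)$.
   Context: Graphs are finite multigraphs without loops (parallel edges allowed); $\chi(G)$ is the ordinary chromatic number. A signed graph $(G,\sigma)$ is a graph $G$ with a signature $\sigma:E(G)\to\{+,-\}$. A circuit is a connected 2-regular (sub)graph; it is balanced (positive) if the product of the signs of its edges is $+$, unbalanced (negative) otherwise. A signed graph is balanced if all its circuits are balanced. The frustration index $l(G,\sigma)$ is the minimum number of edges which have to be removed from $(G,\sigma)$ to make it balanced. A symmetric set is a set $S$ with an involution $s\mapsto -s$ on $S$; $s$ is self-inverse if $s=-s$. $S_{2k}^t$ ($t,k\ge 0$) is the symmetric set with exactly $t$ self-inverse elements $0_1,\dots,0_t$ and $2k$ non-self-inverse elements $\pm s_1,\dots,\pm s_k$. A proper $S_{2k}^t$-coloring of $(G,\sigma)$ is a map $c:V(G)\to S_{2k}^t$ with $c(v)\ne\sigma(e)c(w)$ for every edge $e=vw$. For $t\in\{0,\dots,\chi(G)\}$, $\chi_{sym}^t(G,\sigma)$ is the minimum of $t+2k$ over all $k\ge0$ for which $(G,\sigma)$ has a proper $S_{2k}^t$-coloring. The symset chromatic number is $\chi_{sym}(G,\sigma)=\min\{\chi_{sym}^t(G,\sigma):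 0\le t\le\chi(G)\}$. *)

(* Defs.v *)
From mathcomp Require Import all_boot.

Set Implicit Arguments.
Unset Strict Implicit.
Unset Printing Implicit Defensive.

(* Finite loopless multigraphs: distinct edges may have the same set of ends. *)
Record mgraph := MGraph {
  vertex : finType;
  edge : finType;
  ends : edge -> {set vertex};
  card_ends : forall e, #|ends e| = 2 }.

(* The group {+,-} is represented by bool: true is -, false is +, and the
   product of signs is addb. *)
Definition signature (G : mgraph) := edge G -> bool.

Section Graph.
Variable G : mgraph.
Implicit Types (W : {set vertex G}) (F : {set edge G}).

Lemma ends_neq (e : edge G) u v : ends e = [set u; v] -> u != v.
Proof.
by move=> Ee; move: (card_ends e); rewrite Ee cards2; case: (u != v).
Qed.

Definition adj F : rel (vertex G) :=
  fun u v => [exists e in F, ends e == [set u; v]].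

Definition degree F (v : vertex G) := #|[set e in F | v \in ends e]|.

Definition subgraph W F := [forall e in F, ends e \subset W].

(* When (W, F) is a subgraph, paths along edges of F between vertices of W
   stay in W. *)
Definition connected W F :=
  (W != set0) && [forall u in W, forall v in W, connect (adj F) u v].

Definition regular2 W F := [forall v in W, degree F v == 2].

Definition circuit W F := [&& subgraph W F, connected W F & regular2 W F].

Definition sign_prod (sigma : signature G) F :=
  \big[addb/false]_(e in F) sigma e.

Definition balanced (sigma : signature G) :=
  [forall W, forall F, circuit W F ==> (sign_prod sigma F == false)].

Definition proper n (c : {ffun vertex G -> 'I_n}) :=
  [forall e : edge G, forall v, forall w,
     (ends e == [set v; w]) ==> (c v != c w)].

Definition colorable n := [exists c : {ffun vertex G -> 'I_n}, proper c].

Lemma colorable_ex : exists n, colorable n.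
Proof.
exists #|vertex G|; apply/existsP; exists [ffun v => enum_rank v].
apply/forallP=> e; apply/forallP=> v; apply/forallP=> w.
apply/implyP=> /eqP /ends_neq; apply: contra_neq.
by rewrite !ffunE => /enum_rank_inj.
Qed.

Definition chi := ex_minn colorable_ex.

Section Delete.
Variable F : {set edge G}.

Definition del_ends (e : {e : edge G | e \notin F}) := ends (val e).

Lemma card_del_ends e : #|del_ends e| = 2.
Proof. exact: card_ends. Qed.

Definition del_edges : mgraph := MGraph card_del_ends.

Definition del_sign (sigma : signature G) : signature del_edges :=
  fun e => sigma (val e).

End Delete.
End Graph.

Arguments del_sign {G} F sigma.

Lemma frustration_ex (G : mgraph) (sigma : signature G) :
  exists n, [exists F : {set edge G}, (#|F| == n) && balanced (del_sign F sigma)].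
Proof.
exists #|[set: edge G]|; apply/existsP; exists setT; rewrite eqxx /=.
apply/forallP=> W; apply/forallP=> F; apply/implyP=> _.
by rewrite /sign_prod big1 // => -[e He] _; case/negP: (He); rewrite inE.
Qed.

Definition frustration_index (G : mgraph) (sigma : signature G) :=
  ex_minn (frustration_ex sigma).

(* The symmetric set S_{2k}^t: inl i is the self-inverse element 0_i, and
   inr (j, false), inr (j, true) are the elements +s_j, -s_j. *)
Definition symset (t k : nat) : finType := ('I_t + 'I_k * bool)%type.

Definition symopp t k (s : symset t k) : symset t k :=
  match s with
  | inl i => inl i
  | inr (j, b) => inr (j, ~~ b)
  end.

Lemma symoppK t k : involutive (@symopp t k).
Proof. by case=> [i|[j b]] //=; rewrite negbK. Qed.

Lemma card_symset t k : #|symset t k| = t + 2 * k.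
Proof. by rewrite card_sum card_prod card_bool !card_ord mulnC. Qed.

Lemma card_self_inverse t k : #|[set s : symset t k | symopp s == s]| = t.
Proof.
have -> : [set s : symset t k | symopp s == s] = inl @: [set: 'I_t].
  apply/setP=> -[i|[j b]]; rewrite inE /=.
    by rewrite eqxx mem_imset ?inE // => x y [].
  by apply/eqP/imsetP => [[]|[]//]; case: b.
by rewrite card_imset ?cardsT ?card_ord // => x y [].
Qed.

Definition symact t k (b : bool) (s : symset t k) := if b then symopp s else s.

Section SymColoring.
Variables (G : mgraph) (sigma : signature G).

Definition sym_proper t k (c : {ffun vertex G -> symset t k}) :=
  [forall e : edge G, forall v, forall w,
     (ends e == [set v; w]) ==> (c v != symact (sigma e) (c w))].

Definition sym_colorable t k :=
  [exists c : {ffun vertex G -> symset t k}, sym_proper c].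

Lemma sym_colorable_ex t :
  exists n, [exists k : 'I_n.+1, (n == t + 2 * k) && sym_colorable t k].
Proof.
pose k := #|vertex G|; have hk : k < (t + 2 * k).+1.
  by rewrite ltnS mul2n -addnn addnA leq_addl.
exists (t + 2 * k); apply/existsP; exists (Ordinal hk); rewrite eqxx /=.
apply/existsP; exists [ffun v => inr (enum_rank v, false)].
apply/forallP=> e; apply/forallP=> v; apply/forallP=> w.
apply/implyP=> /eqP /ends_neq; apply: contra_neq.
by rewrite !ffunE /symact; case: (sigma e) => // -[/enum_rank_inj].
Qed.

(* The minimum of t + 2k over the k such that (G, sigma) has a proper
   S_{2k}^t-coloring; bounding k by t + 2k loses nothing. *)
Definition chi_symt t := ex_minn (sym_colorable_ex t).

(* The default value chi_symt 0 is itself one of the terms. *)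
Definition chi_sym := \big[minn/chi_symt 0]_(t < (chi G).+1) chi_symt t.

End SymColoring.

(* Main.v *)
Require Import Defs.
From mathcomp Require Import all_boot.

(** In a proper coloring with [t] maximum, the vertices colored [s_j] or [-s_j]
    induce a subgraph that is not bipartite: otherwise the pair could be traded
    for two self-inverse colors, and [t + 2] would still be at most [chi G],
    since [t + 2 * k <= chi G].  So that subgraph contains an odd circuit.  Along
    an edge, the sign of the color changes exactly when the edge is positive, so
    every circuit of the subgraph has an even number of positive edges, and an
    odd one is unbalanced.  An edge set whose deletion leaves a balanced graph
    meets each of these [k] disjoint circuits. *)

Set Implicit Arguments.
Unset Strict Implicit.

(** * Two-colorings and odd cycles of a relation *)

Section OddCycle.
Context (T : finType) (e : rel T).

(** This is the bipartite double cover: each step changes sheet, so a walk between the two copies of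
    a vertex projects to an odd closed walk. *)
Definition bicover : rel (T * bool) :=
  fun x y => e x.1 y.1 && (x.2 != y.2).

Lemma bicover_path x p : path bicover x p ->
  path e x.1 (map fst p) /\ (last x p).2 = x.2 (+) odd (size p).
Proof.
elim: p x => [|y p IHp] x /=; first by rewrite addbF.
case/andP=> /andP[-> neq_xy] /IHp[-> ->]; split=> //.
by case: x.2 y.2 (odd _) neq_xy => [] [] [].
Qed.

Lemma bicover_sym : symmetric e -> symmetric bicover.
Proof. by move=> e_sym x y; rewrite /bicover e_sym eq_sym. Qed.

Lemma odd_cycle_of_connect w : connect bicover (w, true) (w, false) ->
  exists2 p, cycle e p & odd (size p).
Proof.
case/connectP=> q /bicover_path[e_q parity_q] last_q.
have {parity_q} odd_q : odd (size q).
  by move: parity_q; rewrite -last_q /=; case: (odd _).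
case/lastP: q e_q last_q odd_q => // q y.
rewrite map_rcons last_rcons size_rcons => e_q def_y odd_q.
by exists (w :: map fst q); [move: e_q; rewrite -def_y | rewrite /= size_map].
Qed.

Lemma nuniq_split (p : seq T) : ~~ uniq p ->
  exists x p0 p1 p2, p = p0 ++ x :: p1 ++ x :: p2.
Proof.
elim: p => //= x p IHp; rewrite negb_and negbK.
case: (boolP (x \in p)) => [|_] /=.
  by case/splitPr=> p1 p2 _; exists x, [::], p1, p2.
by case/IHp=> y [p0 [p1 [p2 ->]]]; exists y, (x :: p0), p1, p2.
Qed.

(* A repeated vertex splits an odd closed walk into two shorter closed walks,
   one of which is odd. *)
Lemma odd_ucycle_of_odd_cycle p : cycle e p -> odd (size p) ->
  exists q, [/\ cycle e q, uniq q & odd (size q)].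
Proof.
have [n] := ubnP (size p); elim: n p => // n IHn p lt_p e_p odd_p.
have [p_uniq | /nuniq_split[x [p0 [p1 [p2 def_p]]]]] := boolP (uniq p).
  by exists p.
pose q1 := x :: p1; pose q2 := x :: p2 ++ p0.
have rot_p : rot (size p0) p = q1 ++ q2.
  by rewrite def_p rot_size_cat /q1 /q2 /= -catA.
have [e_q1 e_q2] : cycle e q1 /\ cycle e q2.
  apply/andP; move: e_p; rewrite -(rot_cycle (size p0)) rot_p /=.
  by rewrite rcons_cat rcons_cons -cat_rcons cat_path last_rcons.
have size_p : size p = size q1 + size q2.
  by rewrite -(size_rot (size p0)) rot_p size_cat.
have [odd1 | even1] := boolP (odd (size q1)).
  apply: (IHn q1) => //; apply: leq_trans (lt_p : size p <= n).
  by rewrite size_p -[X in X < _]addn0 ltn_add2l.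
apply: (IHn q2) => //; last by move: odd_p; rewrite size_p oddD (negPf even1).
by apply: leq_trans (lt_p : size p <= n); rewrite size_p -[X in X < _]add0n ltn_add2r.
Qed.

Lemma connect_bicover u v b : connect e u v ->
  exists c, connect bicover (u, b) (v, c).
Proof.
case/connectP=> p; elim: p u b => [|w p IHp] u b /=.
  by move=> _ ->; exists b.
case/andP=> e_uw e_p /(IHp _ (~~ b) e_p)[c con_wv]; exists c.
by apply: connect_trans con_wv; apply: connect1; rewrite /bicover /= e_uw; case: b.
Qed.

(* If no vertex is joined to its twin in the double cover, then each component
   lifts to two copies, and being in a given copy is a 2-coloring. *)
Lemma two_coloring_or_odd_ucycle : symmetric e ->
  (exists d : T -> bool, forall u v, e u v -> d u != d v) \/
  (exists q, [/\ cycle e q, uniq q & odd (size q)]).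
Proof.
move=> e_sym; have b_sym := sym_connect_sym (bicover_sym e_sym).
have [/existsP[w /odd_cycle_of_connect[p]] | no_odd] :=
  boolP [exists w, connect bicover (w, true) (w, false)].
  by move=> e_p odd_p; right; apply: odd_ucycle_of_odd_cycle odd_p.
left; have {}no_odd w : connect bicover (w, true) (w, false) = false.
  by apply: contraNF no_odd => con_w; apply/existsP; exists w.
(* The copy of a component chosen here is the one that contains the [false] lift of its root. *)
pose d v := connect bicover (root e v, false) (v, true).
exists d => u v e_uv.
have eq_r : root e v = root e u.
  by apply/esym/(rootP (sym_connect_sym e_sym))/connect1.
have b_step b : connect bicover (u, b) (v, ~~ b).
  by apply: connect1; rewrite /bicover /= e_uv; case: b.
rewrite /d eq_r; have [ru_t | ru_f] /= := boolP (connect _ _ (u, true)).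
  apply: contraFN (no_odd v) => /eqP/esym rv_t; rewrite b_sym in rv_t.
  exact: connect_trans rv_t (connect_trans ru_t (b_step true)).
(* A path from the root to [u] lifts; as it cannot end at [(u, true)], it ends at [(u, false)], one
   step from [(v, true)]. *)
have: connect e (root e u) u by rewrite (sym_connect_sym e_sym) connect_root.
case/(connect_bicover false)=> -[] con_u; first by rewrite con_u in ru_f.
by rewrite eq_sym eqbF_neg negbK; apply: connect_trans con_u (b_step false).
Qed.
End OddCycle.

(** Returning after two steps would force length 1, excluded by irreflexivity, or 2, excluded by
    parity. *)
Lemma next_next_neq (T : finType) (e : rel T) (p : seq T) v :
  irreflexive e -> cycle e p -> uniq p -> odd (size p) -> v \in p ->
  next p (next p v) != v.
Proof.
move=> e_irr e_p p_uniq odd_p /rot_to[i q rot_p].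
rewrite -!(next_rot i p_uniq) rot_p; move: odd_p p_uniq e_p.
rewrite -(size_rot i) -(rot_uniq i) -(rot_cycle i) rot_p.
case: q {rot_p} => [|a [|b q]] //=; first by rewrite e_irr.
rewrite eqxx !inE !negb_or => _ /andP[/and3P[va vb _] _] _.
by rewrite [a == v]eq_sym (negPf va) eqxx eq_sym.
Qed.

(** * From an odd cycle of vertices to an odd circuit of the multigraph *)

Section OddCircuit.
Context (G : mgraph) (p : seq (vertex G)).
Hypotheses (adj_p : cycle (adj [set: edge G]) p) (p_uniq : uniq p).
Hypothesis odd_p : odd (size p).

Lemma adj_irr (F : {set edge G}) : irreflexive (adj F).
Proof.
move=> v; apply/existsP=> -[e /andP[_ /eqP/ends_neq]].
by rewrite eqxx.
Qed.

Lemma adj_sym (F : {set edge G}) : symmetric (adj F).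
Proof. by move=> u v; apply: eq_existsb => e; rewrite setUC. Qed.

Lemma next_edge_ex : exists f : vertex G -> edge G,
  {in p, forall v, ends (f v) = [set v; next p v]}.
Proof.
have next_edge v : v \in p -> exists e : edge G, ends e = [set v; next p v].
  by move/(next_cycle adj_p)=> /existsP[e /andP[_ /eqP Ee]]; exists e.
(* A default edge for the vertices off [p]; it exists because [p] has odd size and so is
   nonempty. *)
have [e0] : exists e0 : edge G, true.
  have /hasP[v] : has predT p by rewrite has_predT; case: (size p) odd_p.
  by move/next_edge=> [e _]; exists e.
move=> _; exists (fun v => odflt e0 [pick e | ends e == [set v; next p v]]).
move=> v /next_edge[e Ee]; case: pickP => [f /eqP-> //|/(_ e)].
by rewrite Ee eqxx.
Qed.

(** One edge is chosen from each vertex of [p] to its successor. In the sum of the signs every [c v]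
    occurs twice and cancels, which leaves the parity of the length. *)
Lemma circuit_of_odd_ucycle : exists F : {set edge G},
  [/\ circuit [set v in p] F, odd #|F| &
  forall s c, (forall v w e, v \in p -> w \in p -> ends e = [set v; w] ->
     s e = ~~ (c v (+) c w)) -> sign_prod s F = true].
Proof.
have [f Ef] := next_edge_ex; pose W := [set v in p]; pose F := f @: W.
(* Distinct vertices with the same chosen edge would be successors of each other, a cycle of length
   2. *)
have f_inj : {in W &, injective f}.
  move=> v w; rewrite !inE => pv pw eq_f.
  have: v \in ends (f w) by rewrite -eq_f Ef // !inE eqxx.
  rewrite Ef // !inE => /orP[/eqP //| /eqP def_v].
  have: next p v \in ends (f w) by rewrite -eq_f Ef // !inE eqxx orbT.
  rewrite Ef // !inE => /orP[|].
    have nn_w := next_next_neq (@adj_irr _) adj_p p_uniq odd_p pw.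
    by rewrite def_v (negPf nn_w).
  have pv_next := next_cycle adj_p pv.
  by rewrite -def_v => /eqP eq_v; rewrite eq_v adj_irr in pv_next.
have card_F : #|F| = size p.
  by rewrite card_in_imset // cardsE; apply/card_uniqP.
have F_adj v : v \in p -> adj F v (next p v).
  move=> pv; apply/existsP; exists (f v).
  by rewrite Ef // eqxx andbT imset_f ?inE.
exists F; split; last 2 first.
- by rewrite card_F.
- move=> s c s_c; rewrite /sign_prod big_imset //=.
  rewrite (eq_bigr (fun v => true (+) (c v (+) c (next p v)))); last first.
    move=> v; rewrite inE => pv; apply: s_c; rewrite ?mem_next //.
    exact: Ef.
  rewrite !big_split /=.
  (* [next p] permutes the vertices of [p]. *)
  have -> : \big[addb/false]_(v in W) c (next p v) = \big[addb/false]_(v in W) c v.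
    rewrite [RHS](reindex_inj (can_inj (prev_next p_uniq))).
    by apply: eq_bigl => v; rewrite !inE mem_next.
  rewrite addbb addbF big_const -(card_in_imset f_inj) card_F.
  by rewrite (_ : iter _ _ _ = odd (size p)) //; elim: (size p) => //= n ->.
apply/and3P; split.
- apply/forallP=> e; apply/implyP=> /imsetP[v]; rewrite inE => pv ->.
  by rewrite Ef // subUset !sub1set !inE mem_next pv.
- apply/andP; split.
    apply/set0Pn; have /hasP[v pv _] : has predT p.
      by rewrite has_predT; case: (size p) odd_p.
    by exists v; rewrite inE.
  apply/forall_inP=> u; rewrite inE => pu; apply/forall_inP=> v; rewrite inE => pv.
  (* Iterating [next p] from [u] reaches [v], and every iteration follows an edge of [F]. *)
  rewrite -(fconnect_cycle (cycle_next p_uniq) pu) in pv.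
  rewrite -(iter_findex pv); elim: (findex _ _ _) => //= n IHn.
  apply: connect_trans IHn _; apply/connect1/F_adj.
  by elim: n => //= n; rewrite mem_next.
- apply/forall_inP=> v; rewrite inE => pv.
  have pv' : prev p v \in p by rewrite mem_prev.
  (* The two edges at [v] lead to its successor and its predecessor; they differ by [f_inj], since
     there are no loops. *)
  rewrite /degree (_ : [set e in F | v \in ends e] = [set f v; f (prev p v)]); last first.
    apply/setP=> e; rewrite !inE; apply/andP/orP.
      case=> /imsetP[w]; rewrite inE => pw ->; rewrite Ef // !inE.
      case/orP=> /eqP->; first by left.
      by right; rewrite prev_next.
    case=> /eqP->; rewrite Ef // !inE ?next_prev // eqxx ?orbT;
    by split=> //; apply: imset_f; rewrite inE.
  rewrite cards2; case: (f v =P _) => // /f_inj.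
  rewrite !inE pv pv' => /(_ isT isT) eq_v; move: (next_cycle adj_p pv').
  by rewrite next_prev // -eq_v adj_irr.
Qed.
End OddCircuit.

(** * Symmetric-set colorings and the classes of a color pair *)

Section Colorings.
Context (G : mgraph) (sigma : signature G).

Lemma chi_symt_le t k : sym_colorable sigma t k ->
  chi_symt sigma t <= t + 2 * k.
Proof.
move=> col; rewrite /chi_symt; case: ex_minnP => m _; apply.
have lt_k : k < (t + 2 * k).+1 by rewrite ltnS mul2n -addnn addnA leq_addl.
by apply/existsP; exists (Ordinal lt_k); rewrite eqxx.
Qed.

Lemma sym_colorable_of_chi_symt t k : chi_symt sigma t = t + 2 * k ->
  sym_colorable sigma t k.
Proof.
rewrite /chi_symt; case: ex_minnP => m /existsP[k' /andP[/eqP def_m col]] _.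
by rewrite def_m => /addnI/eqP; rewrite eqn_pmul2l // => /eqP <-.
Qed.

Lemma bigminn_le (I : eqType) (r : seq I) (F : I -> nat) m i :
  i \in r -> \big[minn/m]_(j <- r) F j <= F i.
Proof.
elim: r => //= j r IHr; rewrite big_cons inE => /predU1P[->|/IHr le_i].
  exact: geq_minl.
exact: leq_trans (geq_minr _ _) le_i.
Qed.

Lemma chi_sym_le t : t <= chi G -> chi_sym sigma <= chi_symt sigma t.
Proof.
move=> le_t; rewrite /chi_sym.
pose i := Ordinal (le_t : t < (chi G).+1).
by apply: (@bigminn_le _ _ _ _ i); rewrite mem_index_enum.
Qed.

(** Signs act trivially on self-inverse elements, so an ordinary coloring with [chi G] colors is a
    symmetric one with no pairs. *)
Lemma chi_sym_le_chi : chi_sym sigma <= chi G.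
Proof.
apply: leq_trans (chi_sym_le (leqnn _)) _.
rewrite -[leqRHS]addn0 -[0 in leqRHS](muln0 2); apply: chi_symt_le.
rewrite /chi; case: ex_minnP => n /existsP[c c_proper] _.
apply/existsP; exists [ffun v => inl (c v)].
apply/forallP=> e; apply/forallP=> v; apply/forallP=> w; apply/implyP=> Ee.
move/forallP/(_ e)/forallP/(_ v)/forallP/(_ w): c_proper; rewrite Ee !ffunE /symact.
by case: (sigma e); apply: contra_neq => -[].
Qed.

Lemma sym_properP t k (c : {ffun vertex G -> symset t k}) :
  reflect (forall e v w, ends e = [set v; w] -> c v != symact (sigma e) (c w))
          (sym_proper sigma c).
Proof.
apply: (iffP forallP) => [c_proper e v w Ee | c_proper e].
  by move/forallP/(_ v)/forallP/(_ w): (c_proper e); rewrite Ee eqxx.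
apply/forallP=> v; apply/forallP=> w; apply/implyP=> /eqP; apply: c_proper.
Qed.

Definition pair_class t k (c : {ffun vertex G -> symset t k}) (j : 'I_k) :=
  [set v | if c v is inr (i, _) then i == j else false].

(** At a self-inverse color, [false] is only a default. *)
Definition pair_sign t k (c : {ffun vertex G -> symset t k}) v :=
  if c v is inr (_, b) then b else false.

Lemma pair_classP t k (c : {ffun vertex G -> symset t k}) j v :
  reflect (c v = inr (j, pair_sign c v)) (v \in pair_class c j).
Proof.
rewrite inE /pair_sign; case: (c v) => [i|[i b]]; first by right.
by apply: (iffP eqP) => [-> | []].
Qed.

Lemma pair_class_disjoint t k (c : {ffun vertex G -> symset t k}) i j :
  i <> j -> [disjoint pair_class c i & pair_class c j].
Proof.
move=> neq_ij; apply/pred0P=> v; apply/andP=> -[/pair_classP cv /pair_classP].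
by rewrite {1}cv => -[].
Qed.

(** Within a class, properness forbids equal color signs along a positive edge and opposite ones
    along a negative edge. *)
Lemma pair_class_sign t k (c : {ffun vertex G -> symset t k}) j v w e :
  sym_proper sigma c -> v \in pair_class c j -> w \in pair_class c j ->
  ends e = [set v; w] -> sigma e = ~~ (pair_sign c v (+) pair_sign c w).
Proof.
move/sym_properP=> c_proper /pair_classP cv /pair_classP cw /c_proper.
rewrite cv cw /symact; case: (sigma e) (pair_sign c v) (pair_sign c w);
by case=> [] [] //; rewrite eqxx.
Qed.

Lemma split_pair_class t k (c : {ffun vertex G -> symset t k.+1}) j
    (d : vertex G -> bool) : sym_proper sigma c ->
  (forall v w, v \in pair_class c j -> w \in pair_class c j ->
     adj [set: edge G] v w -> d v != d w) ->
  sym_colorable sigma t.+2 k.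
Proof.
move=> /sym_properP c_proper d_proper.
(* The new self-inverse colors take positions 0 and 1, the old ones shift by 2, and [unlift j]
   renumbers the remaining pairs. *)
pose f v : symset t.+2 k := match c v with
  | inl i => inl (rshift 2 i)
  | inr (i, b) => if unlift j i is Some i' then inr (i', b)
                  else inl (lshift t (if d v then ord0 else ord_max : 'I_2))
  end.
apply/existsP; exists (finfun f); apply/sym_properP=> e v w Ee; rewrite !ffunE /f.
have := c_proper e v w Ee.
case cv: (c v) => [i|[i b]]; case cw: (c w) => [i'|[i' b']].
- by rewrite /symact; case: (sigma e); apply: contra_neq => -[/ord_inj ->].
- case: unliftP => [i'' _ _|_ _]; rewrite /symact; case: (sigma e) => //=;
  by rewrite (inj_eq inl_inj) -val_eqE; case: (d w).
- case: unliftP => [i'' _ _|_ _]; rewrite /symact; case: (sigma e) => //=;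
  by rewrite (inj_eq inl_inj) -val_eqE; case: (d v).
case: unliftP => [j1 ->|def_i]; case: unliftP => [j2 ->|def_i'].
- by rewrite /symact; case: (sigma e); apply: contra_neq => -[-> ->].
- by rewrite /symact; case: (sigma e).
- by rewrite /symact; case: (sigma e).
(* Both ends lie in the class of [j]: only here does [d] have to separate them. *)
move=> _; have: d v != d w.
  apply: d_proper; rewrite ?inE ?cv ?cw ?def_i ?def_i' ?eqxx //.
  by apply/existsP; exists e; rewrite inE Ee eqxx.
by rewrite /symact; case: (sigma e) (d v) (d w) => [] [] [].
Qed.

(** The dichotomy is applied to adjacency with both ends in the class, which keeps an odd cycle
    inside it; [pair_sign c] then serves as the map whose values cancel in the sign product. *)
Lemma pair_class_two_coloring_or_odd_circuit t k
    (c : {ffun vertex G -> symset t k}) j : sym_proper sigma c ->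
  (exists d : vertex G -> bool, forall v w, v \in pair_class c j ->
     w \in pair_class c j -> adj [set: edge G] v w -> d v != d w) \/
  exists WF : {set vertex G} * {set edge G}, WF.1 \subset pair_class c j /\
  [/\ circuit WF.1 WF.2, odd #|WF.2| & sign_prod sigma WF.2 = true].
Proof.
move=> c_proper; pose X := pair_class c j.
pose e : rel (vertex G) := fun u v =>
  [&& u \in X, v \in X & adj [set: edge G] u v].
have e_sym : symmetric e by move=> u v; rewrite /e adj_sym andbCA.
case: (two_coloring_or_odd_ucycle e_sym) => [[d dP] | [p [e_p p_uniq odd_p]]].
  by left; exists d => v w Xv Xw vw; apply: dP; rewrite /e Xv Xw.
right; have p_X v : v \in p -> v \in X by move/(next_cycle e_p)/and3P=> [].
have adj_p : cycle (adj [set: edge G]) p.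
  by apply: sub_cycle e_p => u v /and3P[].
have [F [circF oddF signF]] := circuit_of_odd_ucycle adj_p p_uniq odd_p.
exists ([set v in p], F); split=> /=.
  by apply/subsetP=> v; rewrite inE => /p_X.
split=> //; apply: (signF sigma (pair_sign c)) => v w e' /p_X Xv /p_X Xw.
exact: (pair_class_sign c_proper Xv Xw).
Qed.

(** * Edge deletion and unbalanced circuits *)

Lemma frustrating_edge_set : exists F : {set edge G},
  #|F| = frustration_index sigma /\ balanced (del_sign F sigma).
Proof.
rewrite /frustration_index; case: ex_minnP => n /existsP[F /andP[/eqP <- bal]] _.
by exists F.
Qed.

Lemma val_del_edges (X F : {set edge G}) : [disjoint F & X] ->
  val @: [set e : edge (del_edges X) | val e \in F] = F.
Proof.
move=> /disjointFr FX; apply/setP=> e; apply/imsetP/idP => [[e']|Fe].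
  by rewrite inE => ? ->.
have nX : e \notin X by rewrite FX.
by exists (Sub e nX); rewrite ?inE.
Qed.

(** Deletion keeps the vertex type but makes the edges a subtype, so a circuit that avoids [X] is
    transported along [val], which preserves adjacency and degrees. *)
Lemma circuit_del_edges (X F : {set edge G}) W : [disjoint F & X] ->
  circuit W F -> @circuit (del_edges X) W [set e | val e \in F].
Proof.
move=> disFX /and3P[sub con reg]; have FX := disjointFr disFX.
pose F' := [set e : edge (del_edges X) | val e \in F].
apply/and3P; split.
- apply/forall_inP=> e; rewrite inE => Fe; exact: (forall_inP sub).
- have adjE : @adj (del_edges X) F' =2 adj F.
    move=> u v; apply/existsP/existsP => -[e /andP[Fe Ee]].
      by exists (val e); rewrite inE in Fe; rewrite Fe.
    have nX : e \notin X by rewrite FX.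
    by exists (Sub e nX); rewrite inE Fe.
  case/andP: con => W0 con; apply/andP; split=> //.
  apply/forall_inP=> u Wu; apply/forall_inP=> v Wv.
  rewrite (eq_connect adjE); exact: (forall_inP (forall_inP con u Wu)).
apply/forall_inP=> v Wv; have /eqP <- := forall_inP reg v Wv.
apply/eqP; rewrite /degree -(card_imset _ val_inj); apply: eq_card => e.
apply/imsetP/idP => [[e']|].
  by rewrite !inE => /andP[Fe ve] ->; rewrite Fe.
rewrite inE => /andP[Fe ve]; have nX : e \notin X by rewrite FX.
by exists (Sub e nX); rewrite // !inE Fe.
Qed.

(** Otherwise the circuit would survive the deletion with the same sign product. *)
Lemma unbalanced_circuit_meets (X F : {set edge G}) W :
  balanced (del_sign X sigma) -> circuit W F -> sign_prod sigma F = true ->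
  ~~ [disjoint F & X].
Proof.
move=> bal circF signF; apply/negP=> FX.
have := forallP (forallP bal W) [set e | val e \in F].
rewrite (circuit_del_edges FX circF) /=.
suff -> : sign_prod (del_sign X sigma) [set e | val e \in F] = true by [].
rewrite -signF -{2}(val_del_edges FX) /sign_prod big_imset //.
exact: in2W val_inj.
Qed.

End Colorings.

(** * Disjoint unbalanced odd circuits and the frustration index *)

Unset Implicit Arguments.

Theorem theorem3p1 (G : mgraph) (sigma : signature G) (t k : nat)
    (h_chi : chi_sym sigma = t + 2 * k)
    (h_range : t <= chi G)
    (h_t : chi_symt sigma t = chi_sym sigma)
    (h_max : forall t' : nat,
       t' <= chi G -> chi_symt sigma t' = chi_sym sigma -> t' <= t) :
  (exists (W : 'I_k -> {set vertex G}) (F : 'I_k -> {set edge G}),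
     (forall i : 'I_k,
        [/\ circuit (W i) (F i), odd #|F i| & sign_prod sigma (F i) = true]) /\
     (forall i j : 'I_k, i <> j -> [disjoint W i & W j]))
  /\ k <= frustration_index sigma.
Proof.
have /existsP[c c_proper] : sym_colorable sigma t k.
  by apply: sym_colorable_of_chi_symt; rewrite h_t.
have circuit_ex j : exists WF : {set vertex G} * {set edge G},
    WF.1 \subset pair_class c j /\
    [/\ circuit WF.1 WF.2, odd #|WF.2| & sign_prod sigma WF.2 = true].
  have [[d d_proper] | //] :=
    pair_class_two_coloring_or_odd_circuit j c_proper.
  (* The index [j] rules out [k = 0], so there is a pair to trade. *)
  case: k h_chi c c_proper j d_proper => [|k'] h_chi c c_proper j d_proper.
    by case: (j).
  have le_t2 : chi_symt sigma t.+2 <= chi_sym sigma.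
    rewrite h_chi mulnS addnA addn2.
    exact/chi_symt_le/(split_pair_class c_proper d_proper).
  have le_chi : t.+2 <= chi G.
    apply: leq_trans (chi_sym_le_chi sigma).
    by rewrite h_chi mulnS addnA addn2 leq_addr.
  have /(h_max _ le_chi): chi_symt sigma t.+2 = chi_sym sigma.
    by apply/eqP; rewrite eqn_leq le_t2 chi_sym_le.
  by rewrite ltnNge leqnSn.
have [WF WF_P] := fin_all_exists circuit_ex.
pose W i := (WF i).1; pose F i := (WF i).2.
have W_disj i j : i <> j -> [disjoint W i & W j].
  have [Wi _] := WF_P i; have [Wj _] := WF_P j.
  by move/(pair_class_disjoint c); apply: disjointW.
split; first by exists W, F; split=> // i; case: (WF_P i).
have [X [<- bal_X]] := frustrating_edge_set sigma.
have meet i : exists e, (e \in F i) && (e \in X).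
  have [_ [circF _ signF]] := WF_P i.
  by have /pred0Pn := unbalanced_circuit_meets bal_X circF signF.
have [g gP] := fin_all_exists meet.
(* An edge common to two of the circuits would have its ends in both of their disjoint vertex
   sets. *)
have g_inj : injective g.
  move=> i j eq_g; apply/eqP/negPn/negP=> /eqP/W_disj/pred0P W_ij.
  have sub_end l : ends (g l) \subset W l.
    have [_ [/and3P[sub _ _] _ _]] := WF_P l; have /andP[Fg _] := gP l.
    exact: (forall_inP sub).
  have /card_gt0P[v gv] : 0 < #|ends (g i)| by rewrite card_ends.
  move: (W_ij v); rewrite /= (subsetP (sub_end i)) //.
  by rewrite (subsetP (sub_end j)) -?eq_g.
rewrite -[k]card_ord -(card_imset _ g_inj); apply: subset_leq_card.
by apply/subsetP=> _ /imsetP[i _ ->]; case/andP: (gP i).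
Qed.
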